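(* Let $d\ge1$ and let $\tau$ be a type of degree $d$. Then (1) $a^{-1}(\tau,(d^1))=0$ if $\tau$ is mixed; (2) if $\tau=(b_1^m\cdots b_r^m)$ is $m$-pure with $r$ parts, then $$a^{-1}(\tau,(d^1))=\frac{\mu(m)}{m}\cdot\frac{(-1)^{r-1}}{r}\cdot\frac{r!}{\tau[(1,m)]!\,\tau[(2,m)]!\cdots\tau[(d/m,m)]!}.$$
   Context: A type of degree $d$ is a finite multiset $\tau$ of pairs $(b,m)$ of positive integers with $\sum bm=d$; the pair $(b,m)$ is written $b^m$, $\tau[(b,m)]$ denotes the number of occurrences of $(b,m)$ in $\tau$, and the number of pairs counted with multiplicity is the length of $\tau$. $\tau$ is $m$-pure if every pair in it has second entry $m$, and mixed if it is not $m$-pure for any $m$. For types $\tau=\{(b_1,m_1),\dots,(b_r,m_r)\}$ and $\lambda=\{(c_1,n_1),\dots,(c_s,n_s)\}$ listed in some order, an arrangement of $\tau$ into $\lambda$ is an $r\times s$ matrix $A$ with non-negative integer entries such that $A\vec n=\vec m$ and $A^T\vec b=\vec c$; $a(\tau,\lambda)$ is the number of arrangements (independent of the chosen orderings). The square matrix $(a(\tau,\lambda))_{\tau,\lambda}$ indexed by types of degree $d$ is invertible over $\mathbb Q$, and $a^{-1}(\tau,\lambda)$ denotes the entries of its inverse. $(d^1)$ is the type $\{(d,1)\}$, and $\mu$ is the classical Möbius function. *)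

(* Defs.v *)
From HB Require Import structures.
From mathcomp Require Import all_boot all_order all_algebra.
Set Implicit Arguments. Unset Strict Implicit. Unset Printing Implicit Defensive.
Import Order.TTheory GRing.Theory Num.Theory.
From mathcomp Require Import zify.

(* Pairs (b,m) with 0 <= b,m <= d; a pair b^m of a type of degree d always
   satisfies 1 <= b,m <= d since b*m <= d. *)
Definition pairT (d : nat) := ('I_d.+1 * 'I_d.+1)%type.

(* A multiset of pairs is given by its multiplicity function. *)
Definition is_type (d : nat) (f : {ffun pairT d -> 'I_d.+1}) : bool :=
  [forall p : pairT d, (f p != 0 :> nat) ==> (0 < p.1) && (0 < p.2)] &&
  (\sum_(p : pairT d) p.1 * p.2 * f p == d)%N.

Definition typ (d : nat) := {f : {ffun pairT d -> 'I_d.+1} | is_type f}.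

Definition mult (d : nat) (tau : typ d) (b m : nat) : nat :=
  if (b < d.+1) && (m < d.+1) then (val tau (inord b, inord m) : nat) else 0%N.

Definition tlen (d : nat) (tau : typ d) : nat := (\sum_(p : pairT d) val tau p)%N.

Definition tlist (d : nat) (tau : typ d) : seq (nat * nat) :=
  flatten [seq nseq (val tau p) ((p.1 : nat), (p.2 : nat)) | p <- enum [set: pairT d]].

Definition pure (d : nat) (m : nat) (tau : typ d) : Prop :=
  forall p : pairT d, val tau p != 0 :> nat -> (p.2 : nat) = m.

Definition mixed (d : nat) (tau : typ d) : Prop := forall m : nat, ~ pure m tau.

(* Number of arrangements of the list s = [(b_i,m_i)] into t = [(c_j,n_j)]:
   r x s matrices A with nonnegative integer entries, A n = m, A^T b = c.
   Entries satisfy A_ij <= A_ij * n_j <= m_i <= d, so bounding them by d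
   loses nothing. *)
Definition arr_count (d : nat) (s t : seq (nat * nat)) : nat :=
  #|[set A : {ffun 'I_(size s) * 'I_(size t) -> 'I_d.+1} |
      [forall i : 'I_(size s),
         \sum_(j < size t) A (i, j) * (nth (0,0) t j).2 == (nth (0,0) s i).2] &&
      [forall j : 'I_(size t),
         \sum_(i < size s) A (i, j) * (nth (0,0) s i).1 == (nth (0,0) t j).1]]|.

Definition arr (d : nat) (tau lam : typ d) : nat := arr_count d (tlist tau) (tlist lam).

Definition amx (d : nat) : 'M[rat]_#|{: typ d}| :=
  \matrix_(i, j) ((arr (enum_val i) (enum_val j))%:R)%R.

Definition ainv (d : nat) (tau lam : typ d) : rat :=
  invmx (amx d) (enum_rank tau) (enum_rank lam).

Definition d1_fun (d : nat) : {ffun pairT d -> 'I_d.+1} :=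
  [ffun p : pairT d => inord (((p.1 : nat) == d) && ((p.2 : nat) == 1%N) && (0 < d))%N].

Lemma d1_is_type (d : nat) : is_type (d1_fun d).
Proof.
have Hb : forall x y : bool, (x && y && (0 < d))%N < d.+1.
  by move=> [] [] //=; case: d.
apply/andP; split.
  apply/forallP=> -[b m] /=; rewrite ffunE /=; apply/implyP.
  rewrite inordK //.
  case: (boolP ((b == d :> nat) && (m == 1%N :> nat) && (0 < d))%N) => [/andP[/andP[/eqP-> /eqP->]] -> //|_] //.
rewrite (bigD1 (inord d, inord 1%N)) //= big1 ?addn0.
  rewrite ffunE /= (@inordK d d) // eqxx /=.
  case: d {Hb} => [|d]; first by rewrite !mul0n.
  by rewrite inordK // eqxx /= inordK // !muln1.
move=> [b m] Hp; rewrite ffunE /=.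
case: (boolP ((b == d :> nat) && (m == 1%N :> nat) && (0 < d))%N) => [/andP[/andP[/eqP Hb' /eqP Hm] Hd]|_]; last by rewrite inordK //= muln0.
exfalso; move: Hp; rewrite xpair_eqE negb_and => /orP[]/eqP[]; apply/val_inj=> /=;
  rewrite inordK //; lia.
Qed.

Definition d1 (d : nat) : typ d := exist _ (d1_fun d) (d1_is_type d).

Definition moebius (n : nat) : int :=
  (if n == 0%N then 0
  else if all (fun p => logn p n == 1%N) (primes n) then (-1) ^+ size (primes n)
  else 0)%R.

(* Main.v *)
Require Import Defs.
From HB Require Import structures.
From mathcomp Require Import all_boot all_order all_algebra.
From mathcomp Require Import perm zify ring.
Import Order.TTheory GRing.Theory Num.Theory.
Local Open Scope ring_scope.

(** The matrix is invertible because the potential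
    [\sum b * m * (m + (d - b))] strictly decreases from [tau] to [lam] whenever
    [tau != lam] has an arrangement into [lam], so the matrix is triangular with
    positive diagonal. It then suffices to multiply it by the column [v] of
    claimed values and to find the indicator of [(d^1)].

    Grouping the types [lam] by their purity [n] and length [l], the multinomial
    coefficient in [v lam] counts the orderings of [lam], so that
    [\sum_lam a(tau, lam) l! / \prod_b lam[(b,n)]!] counts the matrices with [l]
    nonzero columns and row sums [k_i = m_i / n] (none unless [n] divides every
    [m_i]). Their sum against [(-1)^(l-1) / l] is the coefficient of [x^k] in
    [ln (\prod_i (1 - x_i)^-1)], which is [1 / k_1] if [tau] has a single part
    and [0] otherwise. Finally [\sum_(n %| m) mu(n)] leaves only [m = 1]. *)

(** * Matrices without zero columns *)

Lemma big_tupleS (R : Type) (idx : R) (op : Monoid.com_law idx) (T : finType)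
    (n : nat) (F : n.+1.-tuple T -> R) :
  \big[op/idx]_t F t = \big[op/idx]_x \big[op/idx]_(t : n.-tuple T) F (cons_tuple x t).
Proof.
rewrite pair_bigA /= (reindex (fun p : T * n.-tuple T => cons_tuple p.1 p.2)) //=.
exists (fun t => (thead t, [tuple of behead t])) => [[x t]|t] _.
  by congr (_, _); apply: val_inj.
by case/tupleP: t => x t; apply: val_inj.
Qed.

Lemma sum_tuple0 (T : finType) (F : 0.-tuple T -> nat) :
  (\sum_t F t = F [tuple])%N.
Proof. rewrite (big_pred1 [tuple]) // => t; apply/esym/eqP; exact: tuple0. Qed.

(** Induction on the first entry: a tuple starting with [x] orders [s] iff its tail orders
    [rem x s], and the products of factorials differ by the factor [count_mem x s]. These factors
    add up to [n.+1]. *)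
Lemma count_tuple_perm_eq (T : finType) (n : nat) (s : seq T) :
  size s = n ->
  ((\sum_(t : n.-tuple T) perm_eq t s) * \prod_x (count_mem x s)`! = n`!)%N.
Proof.
elim: n s => [|n IHn] s Hs.
  rewrite sum_tuple0; move/size0nil: Hs => -> /=.
  by rewrite big1.
rewrite big_tupleS big_distrl /=.
transitivity (\sum_x count_mem x s * n`!)%N; last first.
  rewrite -big_distrl /= factS; congr (_ * _)%N.
  rewrite -Hs -sum1_size [RHS](partition_big id xpredT) //=.
  by apply: eq_bigr => x _; rewrite -sum1_count.
apply: eq_bigr => x _.
have [xs | xNs] := boolP (x \in s); last first.
  rewrite (count_memPn xNs) mul0n big1 ?mul0n // => t _.
  apply/eqP; rewrite eqb0; apply: contra xNs => /perm_mem <-.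
  by rewrite inE eqxx.
have perm_s := perm_to_rem xs.
under eq_bigr => t _ do rewrite (permPr perm_s) perm_cons.
have Hcnt y : count_mem y s = ((x == y) + count_mem y (rem x s))%N.
  by have /seq.permP -> := perm_s.
have Hrem : size (rem x s) = n by rewrite size_rem // Hs.
rewrite -(IHn _ Hrem) mulnCA; congr (_ * _)%N.
rewrite (bigD1 x) //= [in RHS](bigD1 x) //= mulnA; congr (_ * _)%N.
  by rewrite Hcnt eqxx add1n factS.
apply: eq_bigr => y yx; rewrite Hcnt eq_sym (negbTE yx) //.
Qed.

Lemma sum_bin_diag (k l : nat) :
  (\sum_(j < k.+1) 'C(j + l.-1, j) * ((l != 0) || (j == 0 :> nat)) = 'C(k + l, k))%N.
Proof.
case: l => [|l] /=.
  rewrite big_ord_recl /= big1 ?addn0 ?binn //.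
  by move=> i _; rewrite muln0.
under eq_bigr => j _ do rewrite muln1.
elim: k => [|k IHk]; first by rewrite big_ord1 !bin0.
by rewrite big_ord_recr /= IHk [(k.+1 + l.+1)%N]addSn binS addSnnS addnC.
Qed.

(* The first factor corrects the truncated predecessor at [l = 0]. *)
Definition multichoose (l k : nat) : nat := ((l != 0) || (k == 0)) * 'C(k + l.-1, k).

Lemma multichooseS (l k : nat) :
  (\sum_(j < k.+1) multichoose l (k - j) = multichoose l.+1 k)%N.
Proof.
rewrite (reindex_inj rev_ord_inj) /=.
rewrite [RHS]mul1n -sum_bin_diag; apply: eq_bigr => j _.
have jk : (j <= k)%N by rewrite -ltnS.
have -> : (k - (k.+1 - j.+1) = j)%N by lia.
by rewrite /multichoose mulnC.
Qed.

Section ColumnMatrices.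
Variables (I : finType) (d : nat).

Definition nzcol (u : {ffun I -> 'I_d.+1}) := [exists i, u i != 0 :> nat].

(* Matrices are given by the tuple of their columns. *)
Definition nzcol_count (k : I -> nat) (l : nat) : nat :=
  (\sum_(w : l.-tuple {ffun I -> 'I_d.+1})
    ([forall i, \sum_(u <- w) (u i : nat) == k i] && all nzcol w))%N.

Lemma nzcol_countS (k : I -> nat) (l : nat) :
  nzcol_count k l.+1 =
  (\sum_(u : {ffun I -> 'I_d.+1} | nzcol u && [forall i, u i <= k i])
     nzcol_count (fun i => k i - u i) l)%N.
Proof.
rewrite /nzcol_count big_tupleS [RHS]big_mkcond /=; apply: eq_bigr => u _.
case: ifP => [/andP[nzu /forallP uk]|Hu].
  apply: eq_bigr => w _; rewrite /= nzu /=; congr (_ && _ : nat).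
  apply: eq_forallb => i; rewrite big_cons; apply/eqP/eqP; have := uk i; lia.
apply: big1 => w _; apply/eqP; rewrite eqb0 /=; apply/negP.
move=> /andP[/forallP Hw /andP[nzu _]]; move: Hu; rewrite nzu /=.
move/negP; case; apply/forallP => i; move/eqP: (Hw i); rewrite big_cons; lia.
Qed.

Lemma nzcol_count0 (k : I -> nat) : nzcol_count k 0 = [forall i, k i == 0]%N.
Proof.
rewrite /nzcol_count sum_tuple0 /= andbT; congr (nat_of_bool _).
by apply: eq_forallb => i; rewrite big_nil eq_sym.
Qed.

(** Row by row this is [multichooseS]: choosing a value [u i] in every row is choosing a column [u],
    and [k i <= d] makes all needed values available. *)
Lemma sum_prod_multichoose (k : I -> nat) (l : nat) : (forall i, k i <= d)%N ->
  (\sum_(u : {ffun I -> 'I_d.+1} | [forall i, u i <= k i])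
      \prod_i multichoose l (k i - u i) = \prod_i multichoose l.+1 (k i))%N.
Proof.
move=> kd; transitivity (\prod_i \sum_(j < d.+1)
    (if (j <= k i)%N then multichoose l (k i - j) else 0))%N.
  rewrite bigA_distr_bigA /= big_mkcond /=; apply: eq_bigr => u _.
  case: ifP => [/forallP uk|/negbT]; first by apply: eq_bigr => i _; rewrite uk.
  rewrite negb_forall => /existsP[i /negbTE Hi].
  by rewrite (bigD1 i) //= Hi mul0n.
apply: eq_bigr => i _; rewrite -multichooseS -big_mkcond /=.
rewrite (big_ord_widen_cond d.+1 xpredT (fun j => multichoose l (k i - j))) ?ltnS //.
Qed.

(* A matrix is a choice of its nonzero columns together with a matrix without
   zero columns. *)
Lemma prod_multichoose (L l : nat) (k : I -> nat) :
  (l <= L)%N -> (forall i, k i <= d)%N ->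
  (\prod_i multichoose l (k i) = \sum_(t < L.+1) 'C(l, t) * nzcol_count k t)%N.
Proof.
elim: l L k => [|l IHl] L k.
  move=> _ _; rewrite big_ord_recl [X in (_ + X)%N]big1 //= addn0.
  rewrite bin0 mul1n nzcol_count0.
  case: (boolP [forall i, k i == 0%N]) => [/forallP k0|].
    by apply: big1 => i _; rewrite (eqP (k0 i)).
  rewrite negb_forall => /existsP[i /negbTE Hi].
  by rewrite (bigD1 i) //= /multichoose Hi.
case: L => // L lL kd.
have kd' (u : {ffun I -> 'I_d.+1}) i : (k i - u i <= d)%N.
  by rewrite (leq_trans (leq_subr _ _)).
(* One column [u] is split off. The zero column and the nonzero ones give the two halves of Pascal's
   rule for ['C(l.+1, t.+1)]. *)
rewrite big_ord_recl -sum_prod_multichoose //=.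
transitivity (\prod_i multichoose l (k i) +
   \sum_(u : {ffun I -> 'I_d.+1} | nzcol u && [forall i, u i <= k i])
      \prod_i multichoose l (k i - u i))%N.
  rewrite (bigID nzcol) /= addnC; congr (_ + _)%N; last first.
    by apply: eq_bigl => u; rewrite andbC.
  rewrite (big_pred1 [ffun=> ord0]) => [|u].
    by apply: eq_bigr => i _; rewrite ffunE subn0.
  rewrite /nzcol negb_exists; apply/andP/eqP => [[_ /forallP u0]|->].
    apply/ffunP=> i; rewrite ffunE; apply/val_inj => /=.
    by apply/eqP; have := u0 i; rewrite negbK.
  by split; apply/forallP=> i; rewrite ffunE.
rewrite (IHl L.+1 k) //; last exact: ltnW.
rewrite [in LHS]big_ord_recl /= !bin0 -addnA; congr (_ + _)%N.
transitivity (\sum_(t < L.+1) 'C(l, t.+1) * nzcol_count k t.+1 +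
   \sum_(t < L.+1) 'C(l, t) * nzcol_count k t.+1)%N; last first.
  by rewrite -big_split /=; apply: eq_bigr => t _; rewrite binS mulnDl.
congr (_ + _)%N.
under [RHS]eq_bigr => t _ do rewrite nzcol_countS big_distrr.
rewrite exchange_big /=; apply: eq_bigr => u _.
exact: IHl.
Qed.

End ColumnMatrices.

(** * Binomial polynomials and the coefficient of the logarithm *)

Definition bin_poly (t : nat) : {poly rat} :=
  (t`!%:R)^-1 *: \prod_(i < t) ('X - i%:R%:P).

(** Rising factorial over [k!], with each factor written as ['X] minus a constant so that the size
    of the product can be read off. *)
Definition multichoose_poly (k : nat) : {poly rat} :=
  (k`!%:R)^-1 *: \prod_(i < k) ('X - (- i%:R)%:P).

Lemma horner_bin_poly (t l : nat) : (bin_poly t).[l%:R] = 'C(l, t)%:R.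
Proof.
apply: (mulfI (x := t`!%:R)); first by rewrite pnatr_eq0 -lt0n fact_gt0.
rewrite /bin_poly hornerZ mulrA divff ?mul1r; last by rewrite pnatr_eq0 -lt0n fact_gt0.
rewrite -natrM mulnC bin_ffact horner_prod.
elim: t => [|t IHt]; first by rewrite big_ord0 ffactn0.
rewrite big_ord_recr IHt ffactnSr natrM !hornerE /=.
have [tl|lt] := leqP t l; first by rewrite natrB.
by rewrite ffact_small // !mul0r.
Qed.

Lemma multichoose_fact (l k : nat) :
  (multichoose l k * k`! = \prod_(i < k) (l + i))%N.
Proof.
elim: k => [|k IHk]; first by rewrite big_ord0 /multichoose orbT bin0.
rewrite big_ord_recr /= -IHk /multichoose factS.
case: l {IHk} => [|l] /=; first by case: k.
have := mul_bin_diag (k + l.+1) k; rewrite addSn addnS /= !mul1n => H.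
by rewrite mulnA [('C(_, _) * _)%N]mulnC -H; ring.
Qed.

Lemma horner_multichoose_poly (k l : nat) :
  (multichoose_poly k).[l%:R] = (multichoose l k)%:R.
Proof.
apply: (mulfI (x := k`!%:R)); first by rewrite pnatr_eq0 -lt0n fact_gt0.
rewrite hornerZ mulrA divff ?mul1r; last by rewrite pnatr_eq0 -lt0n fact_gt0.
rewrite -natrM mulnC multichoose_fact horner_prod natr_prod.
by apply: eq_bigr => i _; rewrite !hornerE opprK natrD.
Qed.

Lemma size_bin_poly (t : nat) : (size (bin_poly t) <= t.+1)%N.
Proof.
rewrite (leq_trans (size_scale_leq _ _)) // size_prod_XsubC.
by rewrite [index_enum _]unlock -enumT size_enum_ord.
Qed.

Lemma size_multichoose_poly (k : nat) : (size (multichoose_poly k) <= k.+1)%N.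
Proof.
rewrite (leq_trans (size_scale_leq _ _)) // size_prod_XsubC.
by rewrite [index_enum _]unlock -enumT size_enum_ord.
Qed.

Lemma prod_ordS (n : nat) : (\prod_(i < n) i.+1 = n`!)%N.
Proof. by rewrite fact_prod big_add1 big_mkord. Qed.

(** The factor [i = 0] is ['X]; the others multiply at [0] to [(-1)^(t-1) (t-1)!], and dividing by
    [t!] leaves [1 / t]. *)
Lemma bin_poly_coef1 (t : nat) : (0 < t)%N ->
  (bin_poly t)`_1 = (-1) ^+ t.-1 / t%:R.
Proof.
case: t => // t _; rewrite coefZ big_ord_recl subr0 coefXM /= -horner_coef0.
rewrite horner_prod (eq_bigr (fun i : 'I_t => -1 * i.+1%:R)) => [|i _]; last first.
  by rewrite !hornerE mulN1r.
rewrite big_split /= prodr_const card_ord -natr_prod prod_ordS factS natrM invfM mulrC -!mulrA.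
congr (_ * _); rewrite mulrCA divff ?mulr1 // pnatr_eq0 -lt0n fact_gt0 //.
Qed.

Lemma multichoose_poly_factor (k : nat) : (0 < k)%N ->
  exists2 q : {poly rat}, multichoose_poly k = 'X * q & q.[0] = k%:R^-1.
Proof.
case: k => // k _.
exists ((k.+1`!%:R)^-1 *: \prod_(i < k) ('X - (- i.+1%:R)%:P)).
  rewrite /multichoose_poly big_ord_recl /= scalerAr; congr (_ * _).
  by rewrite -[RHS]subr0 -polyC0 -oppr0.
rewrite hornerZ horner_prod (eq_bigr (fun i : 'I_k => i.+1%:R)) => [|i _]; last first.
  by rewrite !hornerE opprK.
rewrite -natr_prod prod_ordS factS natrM.
by rewrite invfM -mulrA mulVf ?mulr1 // pnatr_eq0 -lt0n fact_gt0.
Qed.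

Section LogCoefficient.
Variables (I : finType) (d : nat) (k : I -> nat).
Hypothesis kd : forall i, (0 < k i <= d)%N.

(** Both sides have degree at most [L] and agree at the [L + 1] points [0, ..., L] by
    [prod_multichoose]. *)
Lemma prod_multichoose_polyE (L : nat) : (\sum_i k i <= L)%N ->
  \prod_i multichoose_poly (k i) =
  \sum_(t < L.+1) (nzcol_count I d k t)%:R *: bin_poly t.
Proof.
move=> kL; apply/eqP; rewrite -subr_eq0; apply/eqP.
pose rs := [seq l%:R : rat | l <- iota 0 L.+1].
apply: (@roots_geq_poly_eq0 _ _ rs).
- apply/allP => _ /mapP[l lL ->]; rewrite mem_iota in lL.
  rewrite rootE hornerD hornerN horner_prod horner_sum subr_eq0.
  under eq_bigr => i _ do rewrite horner_multichoose_poly.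
  under [X in _ == X]eq_bigr => t _ do rewrite hornerZ horner_bin_poly -natrM mulnC.
  rewrite -natr_prod -natr_sum (@prod_multichoose I d L) //.
  by move=> i; case/andP: (kd i).
- by rewrite map_inj_uniq ?iota_uniq // => x y /eqP; rewrite eqr_nat => /eqP.
rewrite size_map size_iota (leq_trans (size_polyD _ _)) // geq_max size_polyN.
apply/andP; split; last first.
  apply: (leq_trans (size_sum _ _ _)); apply/bigmax_leqP => t _.
  by rewrite (leq_trans (size_scale_leq _ _)) // (leq_trans (size_bin_poly _)).
apply: (leq_trans (size_poly_prod_leq _ _)); rewrite leq_subLR.
have : (\sum_i size (multichoose_poly (k i)) <= \sum_i (k i + 1))%N.
  by apply: leq_sum => i _; rewrite addn1 size_multichoose_poly.
rewrite big_split /= sum1_card => H; rewrite addnS ltnS.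
by rewrite (leq_trans H) // addnC leq_add2l.
Qed.

(* The coefficient of ['X] in [bin_poly t] is the coefficient of [u^t] in
   [ln (1 + u)], so this is the coefficient of [x^k] in
   [ln (\prod_i (1 - x_i)^-1)]. *)
Lemma sum_sign_nzcol_count (L : nat) : (\sum_i k i <= L)%N ->
  \sum_(1 <= t < L.+1) (-1) ^+ t.-1 / t%:R * (nzcol_count I d k t)%:R =
  (#|I| == 1)%N%:R / (\prod_i k i)%:R :> rat.
Proof.
move=> /prod_multichoose_polyE/(congr1 (fun p : {poly rat} => p`_1)).
rewrite coef_sum big_ord_recl coefZ /bin_poly big_ord0 coefZ coef1 !mulr0 add0r.
under [X in _ = X -> _]eq_bigr => t _ do rewrite coefZ bin_poly_coef1 // mulrC.
rewrite big_add1 big_mkord => <-.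
have [q qX q0] : {q : I -> {poly rat} |
    forall i, multichoose_poly (k i) = 'X * q i & forall i, (q i).[0] = (k i)%:R^-1}.
  have H i : exists q : {poly rat},
      (multichoose_poly (k i) == 'X * q) && (q.[0] == (k i)%:R^-1).
    case/andP: (kd i) => /multichoose_poly_factor[q -> q0] _.
    by exists q; rewrite q0 !eqxx.
  exists (fun i => xchoose (H i)) => i;
    by case/andP: (xchooseP (H i)) => /eqP ? /eqP ?.
under eq_bigr => i _ do rewrite qX.
(* The product is ['X^#|I|] times [\prod_i q i]. Its coefficient of ['X] vanishes for two or more
   rows and is [(q i).[0]] for a single row [i]; for no row the product is [1]. *)
rewrite big_split /= prodr_const coefXnM (_ : #|_| = #|I|) //.
case: ltngtP => [c1 | c1 | <-].
- by rewrite mul0r.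
- have I0 : #|I| = 0%N by case: #|I| c1.
  rewrite mul0r I0 big1 ?coef1 // => i _.
  by have := @fintype0 _ i; rewrite I0.
rewrite subnn -horner_coef0 horner_prod mul1r natr_prod -prodfV.
exact: eq_bigr.
Qed.

End LogCoefficient.

(** * The Moebius function *)

Lemma moebius_primeM (p n : nat) : prime p -> ~~ (p %| n)%N ->
  moebius (p * n) = - moebius n.
Proof.
move=> pp pn; have n0 : (0 < n)%N by case: n pn; rewrite ?dvdn0.
have p0 := prime_gt0 pp.
rewrite /moebius muln_eq0 !gtn_eqF //=.
have Hp : perm_eq (primes (p * n)) (p :: primes n).
  apply: uniq_perm; rewrite ?primes_uniq //=.
    by rewrite mem_primes (negbTE pn) !andbF primes_uniq.
  by move=> q; rewrite primesM // inE primes_prime // inE.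
rewrite (perm_size Hp) (perm_all _ Hp) /= lognM // logn_prime // eqxx.
have -> : logn p n = 0%N by apply/eqP; rewrite -leqn0 leqNgt logn_gt0 mem_primes (negbTE pn) !andbF.
rewrite addn0 eqxx /=.
have -> : all (fun q => logn q (p * n) == 1%N) (primes n) =
          all (fun q => logn q n == 1%N) (primes n).
  apply: eq_in_all => q; rewrite mem_primes => /and3P[pq _ qn].
  rewrite lognM // logn_prime //; case: (q =P p) => // qp.
  by rewrite -qp qn in pn.
by case: ifP; rewrite ?oppr0 // exprS mulN1r.
Qed.

Lemma moebius_square_dvd (p n : nat) : prime p -> (p ^ 2 %| n)%N -> moebius n = 0.
Proof.
move=> pp p2n; rewrite /moebius; have [n0|n0] := posnP n; first by [].
case: allP => // /(_ p).
rewrite pfactor_dvdn // in p2n.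
rewrite -logn_gt0 => H; have := H (ltnW p2n); move/eqP; lia.
Qed.

(** For a prime [p] dividing [m], divisors divisible by [p ^ 2] contribute [0], and [n |-> p * n]
    matches the divisors prime to [p] with those divisible by [p] exactly once, with opposite
    signs. *)
Lemma sum_moebius_divisors (m : nat) : (0 < m)%N ->
  \sum_(n <- divisors m) moebius n = (m == 1)%N%:R.
Proof.
move=> m0; case: eqVneq => [-> | m1]; first by rewrite big_seq1.
pose p := pdiv m; have pp : prime p by rewrite pdiv_prime // ltn_neqAle eq_sym m1.
have pm : (p %| m)%N by exact: pdiv_dvd.
have p0 := prime_gt0 pp.
rewrite (bigID (dvdn p)) (bigID (dvdn (p ^ 2))) /= big1 ?add0r; last first.
  by move=> n /andP[_]; exact: moebius_square_dvd.
apply/eqP; rewrite addr_eq0 -sumrN -big_filter -[X in _ == X]big_filter.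
rewrite (perm_big [seq (p * n)%N | n <- divisors m & ~~ (p %| n)%N]) /=.
  rewrite big_map !big_filter; apply/eqP; apply: eq_bigr => n.
  exact: moebius_primeM.
apply: uniq_perm; first by rewrite filter_uniq ?divisors_uniq.
  rewrite map_inj_uniq ?filter_uniq ?divisors_uniq // => x y /eqP.
  by rewrite eqn_pmul2l // => /eqP.
move=> n; rewrite mem_filter -dvdn_divisors //.
apply/idP/mapP => [/andP[/andP[/dvdnP[q ->]]]|[q]].
  rewrite expnS expn1 dvdn_pmul2r // => pq qm; exists q; last exact: mulnC.
  by rewrite mem_filter pq -dvdn_divisors // (dvdn_trans (dvdn_mulr _ _) qm).
rewrite mem_filter -dvdn_divisors // => /andP[pq qm] ->.
rewrite dvdn_mulr //= expnS expn1 dvdn_pmul2l // pq Gauss_dvd ?pm //.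
by rewrite prime_coprime.
Qed.

Lemma sum_moebius_dvd (D m : nat) : (0 < m <= D)%N ->
  \sum_(1 <= n < D.+1 | (n %| m)%N) moebius n = (m == 1)%N%:R.
Proof.
move=> /andP[m0 mD]; rewrite -sum_moebius_divisors // -big_filter; apply: perm_big.
apply: uniq_perm; rewrite ?divisors_uniq ?filter_uniq ?iota_uniq // => n.
rewrite mem_filter mem_index_iota -dvdn_divisors //.
case: (boolP (n %| m)%N) => // nm /=.
by rewrite (dvdn_gt0 m0 nm) ltnS (leq_trans (dvdn_leq m0 nm) mD).
Qed.

(** * Arrangements and invertibility *)

(** Arbitrary finite index types for rows and columns allow arrangements to be reindexed without
    lists. *)
Definition arr_card (I J : finType) (d : nat) (b m : I -> nat) (c n : J -> nat) : nat :=
  (\sum_(A : {ffun I * J -> 'I_d.+1})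
     ([forall i, \sum_j A (i, j) * n j == m i] &&
      [forall j, \sum_i A (i, j) * b i == c j]))%N.

Arguments arr_card {I J} d b m c n.

Lemma arr_countE (d : nat) (s t : seq (nat * nat)) :
  arr_count d s t =
  arr_card d (fun i : 'I_(size s) => (nth (0, 0) s i).1) (fun i => (nth (0, 0) s i).2)
             (fun j : 'I_(size t) => (nth (0, 0) t j).1) (fun j => (nth (0, 0) t j).2).
Proof.
by rewrite /arr_count -sum1dep_card big_mkcond; apply: eq_bigr => A _; case: ifP.
Qed.

Lemma arr_card_reindex (I J J' : finType) (d : nat) (b m : I -> nat) (c n : J -> nat)
    (h : J' -> J) : bijective h ->
  arr_card d b m (c \o h) (n \o h) = arr_card d b m c n.
Proof.
case=> g hK gK; rewrite /arr_card.
rewrite (reindex (fun A : {ffun I * J -> 'I_d.+1} => [ffun ij : I * J' => A (ij.1, h ij.2)])).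
  apply: eq_bigr => A _; congr (_ && _ : nat).
    apply: eq_forallb => i; rewrite [in RHS](reindex h) /=; last by exists g => j _.
    by under eq_bigr => j _ do rewrite ffunE.
  apply/forallP/forallP => H j.
    by have := H (g j); rewrite /= gK; under eq_bigr => i _ do rewrite ffunE /= gK.
  by have := H (h j); rewrite /=; under [in X in _ -> X]eq_bigr => i _ do rewrite ffunE /=.
exists (fun A : {ffun I * J' -> 'I_d.+1} => [ffun ij => A (ij.1, g ij.2)]) => A _; apply/ffunP => -[i j];
  by rewrite !ffunE /= ?hK ?gK.
Qed.

Section Potential.
Variables (I J : finType) (d : nat) (b m : I -> nat) (c n : J -> nat).
Variable A : I -> J -> nat.
Hypothesis rowA : forall i, (\sum_j A i j * n j = m i)%N.
Hypothesis colA : forall j, (\sum_i A i j * b i = c j)%N.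
Hypothesis bm_gt0 : forall i, (0 < b i)%N && (0 < m i)%N.
Hypothesis cn_gt0 : forall j, (0 < c j <= d)%N && (0 < n j)%N.

Let A_le (i : I) (j : J) : (0 < A i j)%N -> (n j <= m i)%N && (b i <= c j)%N.
Proof.
move=> Aij; rewrite -rowA -colA; apply/andP; split.
  by rewrite (bigD1 j) //= (leq_trans (leq_pmull _ Aij)) ?leq_addr.
by rewrite (bigD1 i) //= (leq_trans (leq_pmull _ Aij)) ?leq_addr.
Qed.

Let sum_row (G : I -> nat) :
  (\sum_i b i * m i * G i = \sum_(p : I * J) A p.1 p.2 * b p.1 * n p.2 * G p.1)%N.
Proof.
rewrite -(pair_bigA _ (fun i j => A i j * b i * n j * G i)%N) /=.
apply: eq_bigr => i _; rewrite -rowA big_distrr big_distrl /=.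
by apply: eq_bigr => j _; ring.
Qed.

Let sum_col (G : J -> nat) :
  (\sum_j c j * n j * G j = \sum_(p : I * J) A p.1 p.2 * b p.1 * n p.2 * G p.2)%N.
Proof.
rewrite -(pair_bigA _ (fun i j => A i j * b i * n j * G j)%N) /= exchange_big /=.
apply: eq_bigr => j _; rewrite -colA !big_distrl /=.
by apply: eq_bigr => i _; ring.
Qed.

(** Since [b i * m i] and [c j * n j] are row and column sums of [A i j * b i * n j], both
    potentials are sums over cells, with weights [m i + (d - b i)] and [n j + (d - c j)]. A nonzero
    cell has [n j <= m i] and [b i <= c j], so the comparison holds cell by cell. *)
Let potential_leqif :
  (\sum_j c j * n j * (n j + (d - c j)) <= \sum_i b i * m i * (m i + (d - b i))
   ?= iff [forall p : I * J, (0 < A p.1 p.2) ==> (b p.1 == c p.2) && (m p.1 == n p.2)])%N.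
Proof.
rewrite (sum_row (fun i => m i + (d - b i))%N) (sum_col (fun j => n j + (d - c j))%N).
apply: leqif_sum => -[i j] _ /=.
have [-> | A0] := posnP (A i j); first by rewrite !mul0n; split.
have /andP[nm bc] := A_le _ _ A0; have /andP[b0 m0] := bm_gt0 i.
(* The bound [c j <= d] makes the subtractions exact, so equal weights force both [b i = c j] and
   [m i = n j]. *)
have /andP[/andP[c0 cd] n0] := cn_gt0 j.
have w0 : (0 < A i j * b i * n j)%N by rewrite !muln_gt0 A0 b0.
rewrite implyTb; split; first by rewrite leq_pmul2l //; lia.
rewrite eqn_pmul2l //; apply/eqP/andP => [H | [/eqP-> /eqP->] //].
by split; apply/eqP; lia.
Qed.

Lemma arrangement_potential_le :
  (\sum_j c j * n j * (n j + (d - c j)) <= \sum_i b i * m i * (m i + (d - b i)))%N.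
Proof. exact: potential_leqif. Qed.

(** Equality makes every nonzero cell join equal pairs, so all rows and columns of [A] sum to [1]
    and [A] is a permutation matrix. A general [F] admits indicators of single pairs. *)
Lemma arrangement_potential_eq (F : nat -> nat -> nat) :
  (\sum_j c j * n j * (n j + (d - c j)) = \sum_i b i * m i * (m i + (d - b i)))%N ->
  (\sum_i F (b i) (m i) = \sum_j F (c j) (n j))%N.
Proof.
move=> /eqP; rewrite potential_leqif => /forallP /= H.
have {}H i j : (0 < A i j)%N -> b i = c j /\ m i = n j.
  by move=> A0; have := H (i, j); rewrite /= A0 /= => /andP[/eqP-> /eqP->].
have rowA1 i : (\sum_j A i j = 1)%N.
  have /andP[_ m0] := bm_gt0 i; apply/eqP.
  rewrite -(eqn_pmul2r m0) mul1n -[X in _ == X]rowA big_distrl /=; apply/eqP.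
  apply: eq_bigr => j _; have [-> //|A0] := posnP (A i j).
  by have [_ ->] := H _ _ A0.
have colA1 j : (\sum_i A i j = 1)%N.
  have /andP[/andP[c0 _] _] := cn_gt0 j; apply/eqP.
  rewrite -(eqn_pmul2r c0) mul1n -[X in _ == X]colA big_distrl /=; apply/eqP.
  apply: eq_bigr => i _; have [-> //|A0] := posnP (A i j).
  by have [-> _] := H _ _ A0.
transitivity (\sum_i \sum_j A i j * F (b i) (m i))%N.
  by apply: eq_bigr => i _; rewrite -big_distrl /= rowA1 mul1n.
rewrite exchange_big /=; apply: eq_bigr => j _.
transitivity (\sum_i A i j * F (c j) (n j))%N; last by rewrite -big_distrl /= colA1 mul1n.
apply: eq_bigr => i _; have [-> //|A0] := posnP (A i j).
by have [-> ->] := H _ _ A0.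
Qed.

End Potential.

Arguments arrangement_potential_le {I J d b m c n A} rowA colA bm_gt0 cn_gt0.
Arguments arrangement_potential_eq {I J d b m c n A} rowA colA bm_gt0 cn_gt0 F.

Lemma arr_card_diag (I : finType) (d : nat) (b m : I -> nat) : (0 < d)%N ->
  (0 < arr_card d b m b m)%N.
Proof.
move=> d0; pose A := [ffun ij : I * I => inord (ij.1 == ij.2) : 'I_d.+1].
have AE i j : A (i, j) = (i == j) :> nat.
  by rewrite ffunE /= inordK //; case: (i == j).
rewrite /arr_card (bigD1 A) //= (_ : [forall i, _] && _ = true) //.
apply/andP; split; apply/forallP => i; apply/eqP.
  rewrite (bigD1 i) //= AE eqxx mul1n big1 ?addn0 // => j ji.
  by rewrite AE eq_sym (negbTE ji).
rewrite (bigD1 i) //= AE eqxx mul1n big1 ?addn0 // => j ji.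
by rewrite AE (negbTE ji).
Qed.

(** * Types as lists of pairs, and triangularity *)

Section TypeList.
Variable d : nat.
Implicit Types tau lam : typ d.

(** The entries stay in the finite type [pairT d], so that tuples of them can be summed over;
    [tlistE] relates this list to [tlist]. *)
Definition tplist tau : seq (pairT d) :=
  flatten [seq nseq (val tau p) p | p <- enum [set: pairT d]].

Definition npair (p : pairT d) : nat * nat := (p.1 : nat, p.2 : nat).

Lemma npair_inj : injective npair.
Proof. by move=> [b m] [b' m'] [/val_inj -> /val_inj ->]. Qed.

Lemma tlistE tau : tlist tau = map npair (tplist tau).
Proof.
rewrite /tlist /tplist map_flatten -map_comp; congr flatten.
by apply: eq_map => p /=; rewrite map_nseq.
Qed.

Lemma count_tplist tau p : count_mem p (tplist tau) = val tau p.
Proof.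
rewrite /tplist count_flatten -map_comp sumnE big_map big_enum /=.
rewrite (bigD1 p) ?inE //= big1 ?addn0 => [|q /andP[_ qp]]; rewrite count_nseq /=.
  by rewrite eqxx mul1n.
by rewrite (negbTE qp).
Qed.

Lemma sum_tplist tau (F : pairT d -> nat) :
  (\sum_(p <- tplist tau) F p = \sum_(p : pairT d) val tau p * F p)%N.
Proof.
rewrite big_flatten big_map big_enum /=; apply: eq_big => [p|p _]; first by rewrite inE.
by rewrite big_nseq iter_addn_0 mulnC.
Qed.

Lemma size_tplist tau : size (tplist tau) = tlen tau.
Proof.
by rewrite -sum1_size sum_tplist; apply: eq_bigr => p _; rewrite muln1.
Qed.

Lemma tplist_gt0 tau p : p \in tplist tau -> (0 < p.1)%N && (0 < p.2)%N.
Proof.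
case: tau => f Hf; rewrite -has_pred1 has_count count_tplist /= lt0n.
by case/andP: Hf => /forallP/(_ p)/implyP.
Qed.

Lemma sum_tplist_degree tau : (\sum_(p <- tplist tau) p.1 * p.2 = d)%N.
Proof.
rewrite sum_tplist; case: tau => f /= /andP[_ /eqP fd].
by rewrite -[RHS]fd; apply: eq_bigr => p _; rewrite mulnC.
Qed.

Lemma typ_eq tau lam : (forall p, val tau p = val lam p :> nat) -> tau = lam.
Proof. by move=> H; apply/val_inj/ffunP => p; apply/val_inj/H. Qed.

Definition potential tau : nat :=
  (\sum_(p <- tplist tau) p.1 * p.2 * (p.2 + (d - p.1)))%N.

Lemma arr_potential tau lam : arr tau lam != 0%N ->
  (potential lam <= potential tau)%N /\ (potential lam = potential tau -> tau = lam).
Proof.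
have sumE tau0 (F : nat * nat -> nat) :
    (\sum_(p <- tplist tau0) F (npair p) = \sum_(i < size (tlist tau0)) F (nth (0, 0)%N (tlist tau0) i))%N.
  by rewrite -(big_map npair xpredT F) -tlistE (big_nth (0, 0)%N) big_mkord.
have pos tau0 (i : 'I_(size (tlist tau0))) :
   let p := nth (0, 0)%N (tlist tau0) i in (0 < p.1 <= d)%N && (0 < p.2)%N.
  have := mem_nth (0, 0)%N (ltn_ord i); rewrite [X in _ \in X]tlistE => /mapP[p /tplist_gt0 pp ->] /=.
  by case/andP: pp => -> -> /=; rewrite -ltnS ltn_ord.
rewrite /arr arr_countE sum_nat_eq0 negb_forall => /existsP[A] /=.
rewrite eqb0 negbK => /andP[/forallP rowA /forallP colA].
have {}rowA i := eqP (rowA i); have {}colA j := eqP (colA j).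
have bm i : let p := nth (0, 0)%N (tlist tau) (i : 'I_(size (tlist tau))) in
    (0 < p.1)%N && (0 < p.2)%N.
  by rewrite /=; have /andP[/andP[-> _] ->] := pos tau i.
pose F (p : nat * nat) := (p.1 * p.2 * (p.2 + (d - p.1)))%N.
have potE tau0 : potential tau0 = (\sum_(i < size (tlist tau0)) F (nth (0, 0) (tlist tau0) i))%N.
  exact: sumE.
have le_pot := arrangement_potential_le rowA colA bm (pos lam).
have eq_pot G := arrangement_potential_eq rowA colA bm (pos lam) G.
split; first by rewrite !potE.
rewrite !potE => /eq_pot H; apply: typ_eq => p.
have countE tau0 : val tau0 p = (\sum_(i < size (tlist tau0))
    (nth (0, 0) (tlist tau0) i == npair p))%N :> nat.
  rewrite -(sumE _ (fun q => (q == npair p : nat))) -count_tplist -sum1_count.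
  rewrite big_mkcond /=; apply: eq_bigr => q _.
  by rewrite (inj_eq npair_inj); case: eqP.
(* With [F] the indicator of [p], the equal sums are the multiplicities of [p]. *)
by rewrite !countE; exact: (H (fun x y => (x, y) == npair p)).
Qed.

End TypeList.

Arguments tplist {d} tau.
Arguments npair {d} p.
Arguments potential {d} tau.

(** In a nonzero row vector of the left kernel, take an index [i] of maximal potential in the
    support. By triangularity, entry [i] of the product reduces to [u 0 i] times a positive diagonal
    entry. *)
Lemma amx_unit (d : nat) : (0 < d)%N -> amx d \in unitmx.
Proof.
move=> d0; rewrite unitmxE unitfE; apply/negP => /det0P[u u0 uA].
have /rV0Pn[i0 ui0] := u0.
have [i ui imax] := @arg_maxnP _ i0 (fun i => u 0 i != 0)
  (fun i => potential (enum_val i)) ui0.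
have := congr1 (fun M : 'rV[rat]_#|{: typ d}| => M 0 i) uA.
rewrite !mxE (bigD1 i) //= big1 ?addr0 => [|k ki].
  rewrite mxE => /eqP; rewrite mulf_eq0 (negbTE ui) /= pnatr_eq0 eqn0Ngt.
  by rewrite /arr arr_countE arr_card_diag.
have [-> | uk] := eqVneq (u 0 k) 0; first by rewrite mul0r.
rewrite mxE; have [-> | /(@arr_potential d)[pik eqik]] := eqVneq (arr (enum_val k) (enum_val i)) 0%N.
  by rewrite mulr0.
case/eqP: ki; apply/enum_val_inj/eqik/eqP.
by rewrite eqn_leq pik; exact: imax.
Qed.

Lemma eq_arr_card (I J : finType) (d : nat) (b m : I -> nat) (c n c' n' : J -> nat) :
  c =1 c' -> n =1 n' -> arr_card d b m c n = arr_card d b m c' n'.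
Proof.
move=> cc nn; apply: eq_bigr => A _; congr (_ && _ : nat); apply: eq_forallb => i.
  by under eq_bigr => j _ do rewrite nn.
by rewrite cc.
Qed.

(** The permutation becomes a bijection of column indices; this lets any ordering of a type stand
    for its list. *)
Lemma arr_card_perm (I : finType) (d l : nat) (b m : I -> nat) (t : l.-tuple (pairT d))
    (s : seq (nat * nat)) : perm_eq (map npair t) s ->
  arr_card d b m (fun j => (tnth t j).1) (fun j => (tnth t j).2) =
  arr_card d b m (fun j : 'I_(size s) => (nth (0, 0) s j).1) (fun j => (nth (0, 0) s j).2).
Proof.
move=> ts; have e : l = size s by rewrite -(perm_size ts) size_map size_tuple.
have /tuple_permP[p tE] : perm_eq (map npair t) (in_tuple s) by [].
pose h (j : 'I_l) := p (cast_ord e j).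
have hE j : npair (tnth t j) = nth (0, 0)%N s (h j).
  transitivity (nth (0, 0)%N (map npair t) j).
    by rewrite (nth_map (tnth t j)) ?size_tuple // -tnth_nth.
  rewrite tE /h -[RHS](tnth_nth _ (in_tuple s)).
  have -> : j = cast_ord e j :> nat by [].
  by rewrite -tnth_nth tnth_mktuple.
rewrite -(@arr_card_reindex _ _ _ _ _ _ _ _ h).
  by apply: eq_arr_card => j /=; rewrite -hE.
exists (fun j => cast_ord (esym e) ((p^-1)%g j)) => j; rewrite /h.
  by rewrite permK cast_ordK.
by rewrite cast_ordKV permKV.
Qed.

(** * Arrangements into pure types *)

(** The degree condition makes these sequences, for positive [n], exactly the orderings of [n]-pure
    types. *)
Definition pure_seq {d : nat} (n : nat) (t : seq (pairT d)) : bool :=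
  all (fun p : pairT d => (0 < p.1)%N && (p.2 == n :> nat)) t && (\sum_(p <- t) p.1 * p.2 == d)%N.

Section PureSum.
Variables (I : finType) (d : nat) (b m : I -> nat).
Hypothesis b_gt0 : forall i, (0 < b i)%N.
Hypothesis bm_sum : (\sum_i b i * m i = d)%N.

(** After exchanging the sums, [A] determines at most one [t]: its first entries are [A^T b] and its
    second entries [n]. These first entries are positive exactly when [A] has no zero column. *)
Lemma sum_arr_card_pure (n l : nat) : (0 < n <= d)%N ->
  (\sum_(t : l.-tuple (pairT d) | pure_seq n t)
     arr_card d b m (fun j => (tnth t j).1) (fun j => (tnth t j).2) =
   \sum_(A : {ffun I * 'I_l -> 'I_d.+1})
     ([forall i, \sum_j A (i, j) * n == m i] &&
      [forall j, [exists i, A (i, j) != 0 :> nat]]))%N.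
Proof.
move=> /andP[n0 nd]; rewrite exchange_big /=; apply: eq_bigr => A _.
pose s (j : 'I_l) := (\sum_i A (i, j) * b i)%N.
pose t0 := [tuple (inord (s j), inord n) : pairT d | j < l].
rewrite big_mkcond /= (bigD1 t0) //= big1 ?addn0 => [|t tt0]; last first.
  case: ifP => // /andP[/all_tnthP gt _]; apply/eqP; rewrite eqb0.
  apply: contra tt0 => /andP[_ /forallP colA]; apply/eqP/eq_from_tnth => j.
  rewrite tnth_mktuple /s (eqP (colA j)); have /andP[_ /eqP <-] := gt j.
  by rewrite !inord_val; case: (tnth t j).
have rowE : [forall i, \sum_j A (i, j) * (tnth t0 j).2 == m i]%N =
            [forall i, \sum_j A (i, j) * n == m i]%N.
  by apply: eq_forallb => i; under eq_bigr => j _ do rewrite tnth_mktuple inordK //.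
rewrite rowE; case: (boolP [forall i, _]) => [/forallP rowA|_]; last by rewrite if_same.
(* The row conditions give [t0] the degree [d], which also bounds each [s j], so [inord] loses
   nothing. *)
have sum_s : (\sum_j s j * n = d)%N.
  under eq_bigr => j _ do rewrite big_distrl /=.
  rewrite exchange_big /= -[RHS]bm_sum; apply: eq_bigr => i _.
  rewrite -(eqP (rowA i)) big_distrr /=; apply: eq_bigr => j _; ring.
have sd j : (s j <= d)%N.
  rewrite -sum_s (bigD1 j) //= (leq_trans _ (leq_addr _ _)) // leq_pmulr //.
have -> : [forall j, s j == (tnth t0 j).1]%N.
  by apply/forallP => j; rewrite tnth_mktuple inordK // ltnS.
have sum_t0 : (\sum_(p <- t0) p.1 * p.2 = d)%N.
  rewrite big_tuple -[RHS]sum_s; apply: eq_bigr => j _.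
  by rewrite tnth_mktuple !inordK // ltnS.
rewrite /pure_seq sum_t0 eqxx andbT; have -> : all (fun p : pairT d => (0 < p.1)%N && (p.2 == n :> nat)) t0 =
    [forall j, [exists i, A (i, j) != 0 :> nat]]; last by case: ifP.
apply/all_tnthP/forallP => H j.
  have := H j; rewrite tnth_mktuple /= inordK ?ltnS // lt0n sum_nat_eq0 negb_forall.
  move=> /andP[/existsP[i]]; rewrite /= muln_eq0 negb_or => /andP[Aij _] _.
  by apply/existsP; exists i.
rewrite tnth_mktuple /= !inordK ?ltnS // eqxx andbT lt0n sum_nat_eq0 negb_forall.
have /existsP[i Aij] := H j; apply/existsP; exists i; rewrite /= muln_eq0 negb_or Aij.
by have := b_gt0 i; rewrite lt0n.
Qed.

Lemma sum_nzcol_matrix (n l : nat) : (0 < n)%N ->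
  (\sum_(A : {ffun I * 'I_l -> 'I_d.+1})
     ([forall i, \sum_j A (i, j) * n == m i] &&
      [forall j, [exists i, A (i, j) != 0 :> nat]]) =
   [forall i, (n %| m i)%N] * nzcol_count I d (fun i => m i %/ n) l)%N.
Proof.
move=> n0; rewrite /nzcol_count big_distrr /=.
rewrite (reindex (fun w : l.-tuple {ffun I -> 'I_d.+1} =>
   [ffun ij : I * 'I_l => tnth w ij.2 ij.1])) /=.
  apply: eq_bigr => w _; rewrite mulnb andbA; congr (_ && _ : nat).
    have wE i : (\sum_j [ffun ij : I * 'I_l => tnth w ij.2 ij.1] (i, j) * n =
                 (\sum_(u <- w) u i) * n)%N.
      by rewrite big_tuple big_distrl /=; apply: eq_bigr => j _; rewrite ffunE.
    under eq_forallb => i do rewrite wE.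
    apply/forallP/andP => [H | [/forallP nm /forallP H] i].
      split; apply/forallP => i; rewrite -(eqP (H i)) ?dvdn_mull // mulnK //.
    by rewrite (eqP (H i)) divnK // nm.
  apply/forallP/all_tnthP => H j; have /existsP[i] := H j;
    by rewrite ?ffunE => Hi; apply/existsP; exists i; rewrite ?ffunE.
exists (fun A : {ffun I * 'I_l -> 'I_d.+1} => [tuple [ffun i => A (i, j)] | j < l]) => [w|A] _.
  by apply: eq_from_tnth => j; apply/ffunP => i; rewrite tnth_mktuple !ffunE.
by apply/ffunP => -[i j]; rewrite ffunE tnth_mktuple ffunE.
Qed.

Lemma sum_sign_arr_card (n : nat) : (0 < n <= d)%N -> (forall i, 0 < m i)%N ->
  \sum_(1 <= l < d.+1) (-1) ^+ l.-1 / l%:R *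
     (\sum_(t : l.-tuple (pairT d) | pure_seq n t)
        arr_card d b m (fun j => (tnth t j).1) (fun j => (tnth t j).2))%N%:R =
  if [forall i, (n %| m i)%N] then (#|I| == 1)%N%:R / (\prod_i (m i %/ n))%N%:R else 0 :> rat.
Proof.
move=> nd m0; have n0 : (0 < n)%N by case/andP: nd.
have E l := etrans (sum_arr_card_pure n l nd) (sum_nzcol_matrix n l n0).
under [LHS]eq_bigr => l _ do rewrite E.
case: ifP => [/forallP nm|nNm]; last first.
  by rewrite big1 // => l _; rewrite mul0n mulr0.
under [LHS]eq_bigr => l _ do rewrite mul1n.
have md i : (m i <= d)%N.
  by rewrite -bm_sum (bigD1 i) //= (leq_trans _ (leq_addr _ _)) // leq_pmull.
(* Here [d] is both the bound on entries and the range [L]: the [m i %/ n] add up to at most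
   [\sum_i b i * m i = d]. *)
apply: sum_sign_nzcol_count => [i|].
  by rewrite divn_gt0 // dvdn_leq //= ?(leq_trans (leq_div _ _) (md i)) // nm.
by rewrite -[X in (_ <= X)%N]bm_sum; apply: leq_sum => i _;
  rewrite (leq_trans (leq_div _ _)) // leq_pmull.
Qed.

End PureSum.

(** * Orderings of pure types *)

Lemma pure_seq_size (d n : nat) (t : seq (pairT d)) : (0 < n)%N -> pure_seq n t ->
  (size t <= d)%N.
Proof.
move=> n0 /andP[/allP tn /eqP td]; rewrite -[X in (_ <= X)%N]td -sum1_size.
rewrite big_seq [X in (_ <= X)%N]big_seq; apply: leq_sum => p /tn /andP[p0 /eqP pn].
by rewrite muln_gt0 p0 pn.
Qed.

Lemma pure_seq_perm (d n : nat) (s t : seq (pairT d)) : perm_eq s t ->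
  pure_seq n s = pure_seq n t.
Proof. by move=> st; rewrite /pure_seq (perm_all _ st) (perm_big _ st). Qed.

(** The default [d1 d] is never reached on [n]-pure sequences with [n] positive, whose
    multiplicities do form a type. *)
Definition typ_of (d : nat) (t : seq (pairT d)) : typ d :=
  insubd (d1 d) [ffun p => inord (count_mem p t)].

Lemma typ_ofK (d n : nat) (t : seq (pairT d)) : (0 < n)%N -> pure_seq n t ->
  perm_eq t (tplist (typ_of d t)).
Proof.
move=> n0 tn; have /andP[/allP tp /eqP td] := tn.
have cd p : (count_mem p t < d.+1)%N.
  by rewrite ltnS (leq_trans (count_size _ _)) // (pure_seq_size d n).
apply/seq.allP => p _; apply/eqP; rewrite count_tplist insubdK ?ffunE ?inordK //.
apply/andP; split.
  apply/forallP => q; rewrite ffunE inordK // -lt0n -has_count has_pred1.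
  by apply/implyP => /tp /andP[-> /eqP ->].
apply/eqP; rewrite -[RHS]td.
rewrite [RHS](partition_big id xpredT) //=; apply: eq_bigr => q _.
rewrite ffunE inordK // -sum1_count big_distrr /= muln1.
by apply: eq_bigr => p' /eqP ->.
Qed.

Lemma typ_of_perm (d n : nat) (t : seq (pairT d)) (lam : typ d) : (0 < n)%N ->
  pure_seq n (tplist lam) ->
  pure_seq n t && (typ_of d t == lam) = perm_eq t (tplist lam).
Proof.
move=> n0 lamn; apply/andP/idP => [[tn /eqP <-]|t_lam]; first exact: typ_ofK tn.
have tn : pure_seq n t by rewrite (pure_seq_perm d n _ _ t_lam).
split=> //; apply/eqP/typ_eq => p; rewrite -!count_tplist.
by have /seq.permP <- := typ_ofK d n t n0 tn; have /seq.permP -> := t_lam.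
Qed.

(** The multinomial coefficient of the multiplicities, by [orderings_fact]. *)
Definition orderings (d : nat) (lam : typ d) : nat :=
  (\sum_(t : (tlen lam).-tuple (pairT d)) perm_eq t (tplist lam))%N.

Lemma orderings_fact (d : nat) (lam : typ d) :
  (orderings d lam * \prod_p (val lam p)`! = (tlen lam)`!)%N.
Proof.
rewrite -(@count_tuple_perm_eq _ _ (tplist lam)) ?size_tplist //; congr (_ * _)%N.
by apply: eq_bigr => p _; rewrite count_tplist.
Qed.

(** * The column of claimed values *)

Section Column.
Variables (d : nat) (d_gt0 : (0 < d)%N) (tau : typ d).

Let I : finType := 'I_(size (tlist tau)).
Let b (i : I) := (nth (0, 0)%N (tlist tau) i).1.
Let m (i : I) := (nth (0, 0)%N (tlist tau) i).2.

(** Tuples are grouped by [typ_of]: the fibre over [lam] is its set of orderings, each giving the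
    same count [arr tau lam]. *)
Lemma sum_orderings_arr (n l : nat) : (0 < n)%N ->
  (\sum_(lam : typ d | pure_seq n (tplist lam) && (tlen lam == l))
      orderings d lam * arr tau lam =
   \sum_(t : l.-tuple (pairT d) | pure_seq n t)
      arr_card d b m (fun j => (tnth t j).1) (fun j => (tnth t j).2))%N.
Proof.
move=> n0; rewrite [RHS](partition_big (fun t : l.-tuple (pairT d) => typ_of d t)
  (fun lam => pure_seq n (tplist lam) && (tlen lam == l))) /= => [|t tn]; last first.
  have tt := typ_ofK d n t n0 tn.
  by rewrite -(pure_seq_perm d n _ _ tt) tn -size_tplist -(perm_size tt) size_tuple /=.
apply: eq_bigr => lam /andP[lamn /eqP <-].
rewrite /orderings big_distrl [RHS]big_mkcond; apply: eq_bigr => t _ /=.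
rewrite (typ_of_perm d n) //; case: ifP => // t_lam.
rewrite mul1n /arr arr_countE; apply/esym/arr_card_perm.
by rewrite tlistE perm_map.
Qed.

(** Summing over all [n] avoids a case distinction on purity: at most one term is nonzero, that of
    the common second entry of [lam]. *)
Definition d1_weight (lam : typ d) : rat :=
  \sum_(1 <= n < d.+1) (pure_seq n (tplist lam))%:R * ((moebius n)%:~R / n%:R) *
    ((-1) ^+ (tlen lam).-1 / (tlen lam)%:R) * (orderings d lam)%:R.

Let b_gt0 (i : I) : (0 < b i)%N && (0 < m i)%N.
Proof.
have := mem_nth (0, 0)%N (ltn_ord i); rewrite [X in _ \in X]tlistE => /mapP[p pt pE].
by rewrite /b /m pE; exact: tplist_gt0 pt.
Qed.

Let bm_sum : (\sum_i b i * m i = d)%N.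
Proof.
rewrite -[RHS](sum_tplist_degree d tau) -(big_map npair xpredT (fun p => p.1 * p.2)%N).
by rewrite -tlistE (big_nth (0, 0)%N) big_mkord.
Qed.

Lemma sum_arr_d1_weight :
  \sum_(lam : typ d) (arr tau lam)%:R * d1_weight lam =
  \sum_(1 <= n < d.+1 | [forall i, (n %| m i)%N])
    (moebius n)%:~R / n%:R * ((#|I| == 1)%N%:R / (\prod_i (m i %/ n))%N%:R) :> rat.
Proof.
under eq_bigr => lam _ do rewrite big_distrr /=.
rewrite exchange_big /= [RHS]big_mkcond /= big_nat_cond [RHS]big_nat_cond.
apply: eq_bigr => n /andP[/andP[n0 nd] _]; rewrite ltnS in nd.
have n0d : (0 < n <= d)%N by rewrite n0.
have m0 i : (0 < m i)%N by case/andP: (b_gt0 i).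
have b0 i : (0 < b i)%N by case/andP: (b_gt0 i).
have -> : (if [forall i, (n %| m i)%N] then
   (moebius n)%:~R / n%:R * ((#|I| == 1)%N%:R / (\prod_i (m i %/ n))%N%:R) else 0) =
   (moebius n)%:~R / n%:R * (if [forall i, (n %| m i)%N] then
     ((#|I| == 1)%N%:R / (\prod_i (m i %/ n))%N%:R) else 0) :> rat.
  by case: ifP; rewrite ?mulr0.
rewrite -(sum_sign_arr_card _ _ _ _ b0 bm_sum n n0d m0).
under [in RHS]eq_bigr => l _ do rewrite -sum_orderings_arr // natr_sum.
rewrite big_add1 big_mkord.
rewrite [LHS](bigID (fun lam => pure_seq n (tplist lam))) /= [X in _ + X]big1 ?addr0; last first.
  by move=> lam /negbTE ->; rewrite !mul0r mulr0.
have lend (lam : typ d) : pure_seq n (tplist lam) -> (0 < tlen lam <= d)%N.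
  have := pure_seq_size d n (tplist lam) n0.
  rewrite size_tplist => H lamn; rewrite (H lamn) andbT -size_tplist lt0n.
  apply: contraL d_gt0 => /nilP lam0.
  by rewrite -(sum_tplist_degree d lam) lam0 big_nil.
(* An [n]-pure [lam] has length between [1] and [d], so the predecessor of the length indexes the
   partition and the default of [insubd] is not reached. *)
rewrite (partition_big (fun lam : typ d => insubd (Ordinal d_gt0) (tlen lam).-1) xpredT) //= big_distrr /=.
apply: eq_bigr => l _; rewrite big_distrr big_distrr /=.
apply: eq_big => [lam | lam /andP[lamn /eqP lE]].
  case: (boolP (pure_seq n _)) => //= /lend; case: (tlen lam) => // k /= kd.
  by rewrite -(inj_eq val_inj) val_insubd kd.
have tl : tlen lam = l.+1.
  have := lend _ lamn; rewrite -lE; case: (tlen lam) => // k /= kd.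
  by rewrite val_insubd kd.
rewrite lamn mul1r tl natrM; ring.
Qed.

End Column.

Lemma typ_perm (d : nat) (tau lam : typ d) :
  perm_eq (tplist tau) (tplist lam) -> tau = lam.
Proof.
by move=> /seq.permP H; apply: typ_eq => p; rewrite -!count_tplist H.
Qed.

Lemma tplist_d1 (d : nat) : (0 < d)%N -> tplist (d1 d) = [:: (inord d, inord 1)].
Proof.
move=> d0; apply: perm_small_eq => //; apply/seq.allP => -[b m] _; apply/eqP.
rewrite count_tplist /= ffunE d0 andbT addn0 inordK; last by rewrite ltnS; case: (_ && _).
by rewrite xpair_eqE -!(inj_eq val_inj) /= !inordK // (eq_sym d) (eq_sym 1%N).
Qed.

Lemma sum_arr_d1_weightE (d : nat) (tau : typ d) : (0 < d)%N ->
  \sum_(lam : typ d) (arr tau lam)%:R * d1_weight d lam = (tau == d1 d)%:R.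
Proof.
move=> d0; rewrite sum_arr_d1_weight // card_ord.
have [tau1|tau1] := eqVneq (size (tlist tau)) 1%N; last first.
  rewrite big1 => [|n _]; last by rewrite mul0r mulr0.
  case: eqVneq => // tauE; case/eqP: tau1.
  by rewrite tlistE size_map tauE tplist_d1.
have [p pE] : exists p, tplist tau = [:: p].
  by move: tau1; rewrite tlistE size_map; case: (tplist tau) => [|p []] //; exists p.
have /andP[p1 p2] : (0 < p.1)%N && (0 < p.2)%N.
  by apply: (@tplist_gt0 d tau); rewrite pE inE.
have p12 : (p.1 * p.2 = d)%N by rewrite -[RHS](sum_tplist_degree d tau) pE big_seq1.
have mE (i : 'I_(size (tlist tau))) : (nth (0, 0) (tlist tau) i).2 = p.2 :> nat.
  have /= := ltn_ord i; rewrite [X in (_ < X)%N]tau1 ltnS leqn0 => /eqP ->.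
  by rewrite tlistE pE.
have i0 : 'I_(size (tlist tau)) by rewrite tau1; exact: ord0.
have p2d : (0 < p.2 <= d)%N by rewrite p2 -ltnS ltn_ord.
(* For a single part, [1 / n] and [1 / (p.2 / n)] combine to [1 / p.2], independent of [n]. *)
transitivity (\sum_(1 <= n < d.+1 | (n %| p.2)%N) (moebius n)%:~R / p.2%:R : rat).
  rewrite big_nat_cond [RHS]big_nat_cond; apply: eq_big => [n | n /andP[/andP[n0 _] nm]].
    congr (_ && _); apply/forallP/idP => [/(_ i0)|H i]; by rewrite mE.
  have {}nm : (n %| p.2)%N by have /forallP/(_ i0) := nm; rewrite mE.
  under eq_bigr => i _ do rewrite mE.
  rewrite prod_nat_const card_ord tau1 expn1 mul1r -mulrA -invfM -natrM mulnC.
  by rewrite divnK.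
rewrite -mulr_suml -rmorph_sum /= sum_moebius_dvd //.
have -> : (tau == d1 d) = (p.2 == 1%N :> nat).
  apply/eqP/eqP => [tauE | m1].
    have := pE; rewrite tauE tplist_d1 // => -[<-] /=.
    by rewrite inordK.
  apply: typ_perm; rewrite pE tplist_d1 //.
  suff -> : p = (inord d, inord 1) by [].
  by rewrite [p]surjective_pairing; congr (_, _); apply/val_inj;
    rewrite /= inordK // -[RHS]p12 m1 muln1.
case: eqVneq => [->|_]; first by rewrite divr1.
by rewrite mul0r.
Qed.

Lemma ainv_d1 (d : nat) (tau : typ d) : (0 < d)%N -> ainv tau (d1 d) = d1_weight d tau.
Proof.
move=> d0; pose v := \col_i d1_weight d (enum_val i) : 'cV[rat]_#|{: typ d}|.
have Av : amx d *m v = delta_mx (enum_rank (d1 d)) 0.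
  apply/colP => i; rewrite !mxE.
  rewrite (reindex (@enum_rank (typ d))) /=; last first.
    by exists enum_val => ? _; rewrite ?enum_valK ?enum_rankK.
  under eq_bigr => lam _ do rewrite !mxE enum_rankK.
  rewrite sum_arr_d1_weightE //; congr (_%:R); congr nat_of_bool.
  by rewrite andbT -(inj_eq enum_rank_inj) enum_valK.
have -> : d1_weight d tau = v (enum_rank tau) 0 by rewrite mxE enum_rankK.
(* Applying the inverse to [amx d *m v], a unit column, picks out the column of the inverse at
   [(d^1)]. *)
by rewrite -[v](mulKmx (amx_unit d d0)) Av -colE mxE.
Qed.

(** * Evaluation on pure and mixed types *)

Lemma pureP (d m : nat) (tau : typ d) :
  (0 < m)%N -> reflect (pure m tau) (pure_seq m (tplist tau)).
Proof.
move=> m0; apply: (iffP idP) => [/andP[/allP H _] p | H].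
  by rewrite -count_tplist -lt0n -has_count has_pred1 => /H /andP[_ /eqP].
rewrite /pure_seq (sum_tplist_degree d tau) eqxx andbT; apply/allP => p pt.
have /andP[-> _] := tplist_gt0 _ _ _ pt.
by apply/eqP/H; rewrite -count_tplist -lt0n -has_count has_pred1.
Qed.

Lemma tplist_nonempty (d : nat) (tau : typ d) : (0 < d)%N ->
  exists p, p \in tplist tau.
Proof.
move=> d0; case tE: (tplist tau) => [|p t]; last by exists p; rewrite inE eqxx.
by have := sum_tplist_degree d tau; rewrite tE big_nil => dE; rewrite -dE in d0.
Qed.

Lemma pure_mem (d m : nat) (tau : typ d) (p : pairT d) :
  pure m tau -> p \in tplist tau -> p.2 = m :> nat.
Proof. by move=> pm pt; apply: pm; rewrite -count_tplist -lt0n -has_count has_pred1. Qed.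

Lemma pure_gt0 (d m : nat) (tau : typ d) : (0 < d)%N -> pure m tau -> (0 < m <= d)%N.
Proof.
move=> /(tplist_nonempty d tau)[p pt] /pure_mem/(_ pt) <-.
by have /andP[_ ->] := tplist_gt0 _ _ _ pt; rewrite -ltnS ltn_ord.
Qed.

Lemma pure_unique (d m n : nat) (tau : typ d) : (0 < d)%N ->
  pure m tau -> pure n tau -> m = n.
Proof.
by move=> /(tplist_nonempty d tau)[p pt] pm pn; rewrite -(pure_mem _ _ _ _ pm pt);
  exact: pure_mem pn pt.
Qed.

(** All other pairs have multiplicity [0] and contribute [0! = 1]: purity excludes second entries
    other than [m], positivity excludes [b = 0], and the degree excludes [b * m > d]. *)
Lemma prod_mult_fact (d m : nat) (tau : typ d) : (0 < m <= d)%N -> pure m tau ->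
  (\prod_(1 <= b < (d %/ m).+1) (mult tau b m)`! = \prod_p (val tau p)`!)%N.
Proof.
move=> /andP[m0 md] pm.
rewrite [RHS](eq_bigr (fun p => (val tau (p.1, p.2))`!)) => [|[] //].
rewrite -(pair_bigA _ (fun b n => (val tau (b, n))`!)) /=.
have -> : (\prod_b \prod_n (val tau (b, n))`! = \prod_(b < d.+1) (mult tau b m)`!)%N.
  apply: eq_bigr => b _; rewrite (bigD1 (inord m)) //= big1 ?muln1 => [|n nm].
    by rewrite /mult ltn_ord ltnS md inord_val.
  have [->//|/pm /= nE] := eqVneq (val tau (b, n) : nat) 0%N.
  by rewrite -nE inord_val eqxx in nm.
rewrite -(big_mkord xpredT (fun b => (mult tau b m)`!)).
have mult0 b : b = 0%N \/ (d %/ m < b)%N -> mult tau b m = 0%N.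
  rewrite /mult; case: ifP => // /andP[bd _] Hb; apply/eqP/negPn; rewrite -lt0n.
  rewrite -count_tplist -has_count has_pred1; apply/negP => pt.
  have /= := tplist_gt0 _ _ _ pt; rewrite !inordK // => /andP[b0 _].
  have := sum_tplist_degree d tau; rewrite (perm_big _ (perm_to_rem pt)) big_cons /=.
  rewrite !inordK // => dE; case: Hb => [b00|]; first by rewrite b00 in b0.
  by rewrite ltn_divLR // ltnNge -dE leq_addr.
rewrite [RHS]big_ltn // mult0 ?mul1n; last by left.
rewrite [RHS](big_cat_nat _ _ (n := (d %/ m).+1)) //=; last by rewrite ltnS leq_div.
rewrite [X in (_ * X)%N]big_nat_cond [X in (_ * X)%N]big1 ?muln1 // => b.
by rewrite andbT => /andP[mb _]; rewrite mult0 //; right.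
Qed.

Theorem theorem4 (d : nat) (hd : (0 < d)%N) (tau : typ d) :
  (mixed tau -> ainv tau (d1 d) = 0) /\
  (forall m : nat, pure m tau ->
     ainv tau (d1 d) =
       ((moebius m)%:~R / m%:R) *
       ((-1) ^+ (tlen tau).-1 / (tlen tau)%:R) *
       ((tlen tau)`!%:R / (\prod_(1 <= b < (d %/ m).+1) (mult tau b m)`!)%:R)).
Proof.
rewrite ainv_d1 //; split=> [mixed_tau | m pm].
  rewrite /d1_weight big_nat_cond big1 // => n /andP[/andP[n0 _] _].
  case: (pureP d n tau n0) => [/mixed_tau //|_]; by rewrite !mul0r.
have /andP[m0 md] := pure_gt0 d m tau hd pm.
(* Only the term [n = m] survives, as a type of positive degree is pure for at most one value. *)
rewrite /d1_weight (bigD1_seq m) ?mem_index_iota ?iota_uniq ?m0 //=.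
rewrite (introT (pureP d m tau m0) pm) mul1r big_nat_cond big1 ?addr0.
  congr (_ * _); rewrite prod_mult_fact ?m0 // -orderings_fact natrM mulfK //.
  by rewrite pnatr_eq0 -lt0n prodn_gt0 // => p; rewrite fact_gt0.
move=> n /andP[/andP[n0 _] nm].
case: (pureP d n tau n0) => [pn|_]; last by rewrite !mul0r.
by rewrite (pure_unique d n m tau hd pn pm) eqxx in nm.
Qed.
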